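(* Let $\chi:[n]\to\{\ell,c,r\}$, let $\chi^{-1}\{c\}\cap[2,n-1]=\{l_1<\cdots<l_m\}$, $l_0=1$, $l_{m+1}=n$, let $\chi_i=\chi|_{[l_{i-1},l_i]}$ for $i=1,\dots,m+1$ and $\chi'=\chi|_{[l_1,n]}$. For $\pi\in IBNC(\chi)$ let $\alpha_i(\pi)$ be the restriction of $\pi$ to $[l_{i-1},l_i]$ and $\alpha'(\pi)$ the restriction of $\pi$ to $[l_1,n]$. Let $\alpha_1':IBNC(\chi)\to NC(\chi_1)\times IBNC(\chi')$ be the map $$\alpha_1'(\pi)=(\alpha_1(\pi),\alpha'(\pi))$$ and let $\alpha:IBNC(\chi)\to NC(\chi_1)\times NC(\chi_2)\times\cdots\times NC(\chi_{m+1})$ be the map $$\alpha(\pi)=(\alpha_1(\pi),\dots,\alpha_{m+1}(\pi)).$$ Then $\alpha_1'$ and $\alpha$ are lattice isomorphisms, and $IBNC(\chi)$ is a lattice with respect to the reversed refinement order $\le$ on partitions.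
   Context: $[n]=\{1,\dots,n\}$ and $[a,b]=\{a,a+1,\dots,b\}$. For a finite set $S$ of positive integers and a map $\chi:S\to\{\ell,c,r\}$ with $\chi^{-1}\{\ell,c\}=\{i_1<\cdots<i_p\}$ and $\chi^{-1}\{r\}=\{i_{p+1}>\cdots>i_{|S|}\}$, the total order $\prec_\chi$ on $S$ is $i_1\prec_\chi i_2\prec_\chi\cdots\prec_\chi i_{|S|}$. A partition of $S$ is $\chi$-noncrossing if it is noncrossing with respect to $\prec_\chi$ (there are no $s_1\prec_\chi r_1\prec_\chi s_2\prec_\chi r_2$ with $s_1,s_2$ in one block and $r_1,r_2$ in a different block); $NC(\chi)$ is the set of these. A partition is $\chi$-interval if $i,j,k$ are in the same block whenever $i<j<k$ (natural order), $i$ and $k$ are in the same block, and $\chi(j)=c$. $IBNC(\chi)$, the set of interval-bi-noncrossing partitions with respect to $\chi$, is the set of partitions that are both $\chi$-noncrossing and $\chi$-interval. The reversed refinement order is: $\sigma\le\pi$ if each block of $\sigma$ is contained in a block of $\pi$; products carry the componentwise order. The restriction of a partition to a subset $T$ has as blocks the nonempty intersections of its blocks with $T$. *)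

(* Defs.v *)
From HB Require Import structures.
From mathcomp Require Import all_boot all_order.

Set Implicit Arguments.
Unset Strict Implicit.
Unset Printing Implicit Defensive.

Import Order.TTheory.

Variant color := Left | Center | Right.

Definition eq_color (x y : color) : bool :=
  match x, y with
  | Left, Left | Center, Center | Right, Right => true
  | _, _ => false
  end.

Lemma eq_colorP : Equality.axiom eq_color.
Proof. by case=> [] []; constructor. Qed.

HB.instance Definition _ := hasDecEq.Build color eq_colorP.

Section Lattices.

Variables (d d' : Order.disp_t) (T : porderType d) (T' : porderType d').

Definition is_glb (x y z : T) : Prop :=
  [/\ (z <= x)%O, (z <= y)%O & forall t, (t <= x)%O -> (t <= y)%O -> (t <= z)%O].

Definition is_lub (x y z : T) : Prop :=
  [/\ (x <= z)%O, (y <= z)%O & forall t, (x <= t)%O -> (y <= t)%O -> (z <= t)%O].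

Definition is_lattice : Prop :=
  forall x y : T, (exists z, is_glb x y z) /\ (exists z, is_lub x y z).

End Lattices.

Definition lattice_isomorphism (d d' : Order.disp_t) (T : porderType d)
    (T' : porderType d') (f : T -> T') : Prop :=
  [/\ is_lattice T, is_lattice T', bijective f,
      forall x y z, is_glb x y z -> is_glb (f x) (f y) (f z) &
      forall x y z, is_lub x y z -> is_lub (f x) (f y) (f z)].

Section DffunOrder.

Variables (I : finType) (d : Order.disp_t) (T : I -> porderType d).
Notation prodT := {dffun forall i, T i}.

Definition dffun_le (f g : prodT) : bool := [forall i, (f i <= g i)%O].

Fact dffun_le_refl : reflexive dffun_le.
Proof. by move=> f; apply/forallP. Qed.

Fact dffun_le_anti : antisymmetric dffun_le.
Proof.
move=> f g /andP[/forallP fg /forallP gf]; apply/ffunP => i.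
by apply/le_anti; rewrite fg gf.
Qed.

Fact dffun_le_trans : transitive dffun_le.
Proof.
move=> g f h /forallP fg /forallP gh; apply/forallP => i.
exact: le_trans (fg i) (gh i).
Qed.

HB.instance Definition _ :=
  Order.Le_isPOrder.Build (Order.prod_display d d) prodT
    dffun_le_refl dffun_le_anti dffun_le_trans.

End DffunOrder.

Section Partitions.

Variable T : finType.
Implicit Types S D : {set T}.

Record setpart S := SetPart {
  blocks :> {set {set T}};
  setpartP : partition blocks S }.

HB.instance Definition _ S := [isSub for @blocks S].
HB.instance Definition _ S := [Finite of setpart S by <:].

Definition refines S (s p : setpart S) : bool :=
  [forall B in blocks s, exists B' in blocks p, B \subset B'].

Lemma refinesP S (s p : setpart S) :
  reflect (forall B, B \in blocks s -> exists2 B', B' \in blocks p & B \subset B')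
          (refines s p).
Proof. exact: 'forall_in_exists_inP. Qed.

Fact refines_refl S : reflexive (@refines S).
Proof. by move=> s; apply/refinesP => B sB; exists B. Qed.

Fact refines_trans S : transitive (@refines S).
Proof.
move=> p s q /refinesP sp /refinesP pq; apply/refinesP => B /sp[B' /pq[B2 qB2 sub2] sub1].
by exists B2 => //; apply: subset_trans sub1 sub2.
Qed.

Lemma refines_sub S (s p : setpart S) :
  refines s p -> refines p s -> blocks s \subset blocks p.
Proof.
move=> /refinesP sp /refinesP ps; apply/subsetP => B sB.
have [B' pB' BB'] := sp _ sB; have [B2 sB2 B'B2] := ps _ pB'.
have /and3P[_ tI n0] := setpartP s.
suff eB : B = B2 by have -> : B = B' by apply/eqP; rewrite eqEsubset BB' eB.
apply/eqP/negPn/negP => /(trivIsetP tI _ _ sB sB2).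
rewrite -setI_eq0 => /eqP BB2; move: n0; rewrite -BB2.
by rewrite (setIidPl (subset_trans BB' B'B2)) sB.
Qed.

Fact refines_anti S : antisymmetric (@refines S).
Proof.
move=> s p /andP[sp ps]; apply/val_inj/eqP => /=.
by rewrite eqEsubset !refines_sub.
Qed.

Fact refinement_display : Order.disp_t. Proof. exact: (Order.Disp tt tt). Qed.

HB.instance Definition _ S :=
  Order.Le_isPOrder.Build refinement_display (setpart S)
    (@refines_refl S) (@refines_anti S) (@refines_trans S).

Definition restr_blocks D (P : {set {set T}}) : {set {set T}} :=
  [set B :&: D | B in P] :\ set0.

Fact restr_partition S D (sDS : D \subset S) (p : setpart S) :
  partition (restr_blocks D p) D.
Proof.
have /and3P[/eqP cv tI _] := setpartP p; apply/and3P; split.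
- apply/eqP/setP => x; apply/bigcupP/idP => [[B]|xD].
    by rewrite !inE => /andP[_ /imsetP[B' _ ->]]; rewrite inE => /andP[].
  have: x \in cover p by rewrite cv (subsetP sDS).
  case/bigcupP=> B pB xB; exists (B :&: D); last by rewrite inE xB.
  rewrite /restr_blocks in_setD1 (imset_f (fun B => B :&: D)) // andbT.
  by apply/set0Pn; exists x; rewrite inE xB.
- apply/trivIsetP => _ _ /setD1P[_ /imsetP[B pB ->]] /setD1P[_ /imsetP[B' pB' ->]].
  have [-> /eqP//|nBB' _] := eqVneq B B'.
  have := trivIsetP tI _ _ pB pB' nBB'.
  by apply: disjointW; apply: subsetIl.
- by rewrite !inE eqxx.
Qed.

Definition restr S D (sDS : D \subset S) (p : setpart S) : setpart D :=
  SetPart (restr_partition sDS p).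

Lemma restr_block S D (sDS : D \subset S) (p : setpart S) V :
  V \in blocks (restr sDS p) -> exists2 B, B \in blocks p & V = B :&: D.
Proof. by case/setD1P=> _ /imsetP[B pB ->]; exists B. Qed.

End Partitions.

(* The index set {1, ..., N} with N >= 1 is 'I_n.+1 with n.+1 = N, the ordinal
   i standing for the integer i + 1.  A map to {l, c, r} defined on a subset
   S of it is represented by a map chi on the whole of 'I_n.+1 together with S;
   every notion below depends only on the values of chi on S. *)
Section BiNoncrossing.

Variable n : nat.
Implicit Types (chi : 'I_n.+1 -> color) (S D : {set 'I_n.+1}).

(* The elements of S listed in increasing order for the total order prec_chi;
   enum S is increasing for the natural order. *)
Definition chi_seq chi S : seq 'I_n.+1 :=
  [seq i <- enum S | chi i != Right] ++ rev [seq i <- enum S | chi i == Right].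

Definition prec chi S (i j : 'I_n.+1) : bool :=
  index i (chi_seq chi S) < index j (chi_seq chi S).

Definition noncrossing chi S (P : {set {set 'I_n.+1}}) : bool :=
  [forall V in P, forall W in P, (V != W) ==>
    ~~ [exists s1 in V, exists r1 in W, exists s2 in V, exists r2 in W,
          [&& prec chi S s1 r1, prec chi S r1 s2 & prec chi S s2 r2]]].

Definition chi_interval chi S (P : {set {set 'I_n.+1}}) : bool :=
  [forall V in P, forall i in V, forall k in V, forall j in S,
    (i < j < k) && (chi j == Center) ==> (j \in V)].

Record NC chi S := NCPart {
  NC_part :> setpart S;
  NC_partP : noncrossing chi S NC_part }.

HB.instance Definition _ chi S := [isSub for @NC_part chi S].
HB.instance Definition _ chi S := [Finite of NC chi S by <:].
HB.instance Definition _ chi S :=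
  [SubChoice_isSubPOrder of NC chi S by <: with refinement_display].

Record IBNC chi S := IBNCPart {
  IBNC_part :> setpart S;
  IBNC_partP : noncrossing chi S IBNC_part && chi_interval chi S IBNC_part }.

HB.instance Definition _ chi S := [isSub for @IBNC_part chi S].
HB.instance Definition _ chi S := [Finite of IBNC chi S by <:].
HB.instance Definition _ chi S :=
  [SubChoice_isSubPOrder of IBNC chi S by <: with refinement_display].

Lemma index_filter_lt (U : eqType) (a : pred U) (s : seq U) x y : a x -> a y ->
  (index x (filter a s) < index y (filter a s)) = (index x s < index y s).
Proof.
move=> ax ay; elim: s => //= z s IH.
case az: (a z) => /=.
  by case: eqP => _; case: eqP => _ //=; rewrite ltnS IH.
have neq t : a t -> (z == t) = false by move=> at_; apply/eqP => zt; rewrite zt at_ in az.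
by rewrite !neq // ltnS IH.
Qed.

Lemma chi_seq_sub chi S D : D \subset S ->
  chi_seq chi D = [seq i <- chi_seq chi S | i \in D].
Proof.
move=> sDS; have eD : enum D = [seq i <- enum S | i \in D].
  rewrite /enum_mem -filter_predI; apply: eq_filter => i /=.
  by case: (boolP (i \in D)) (subsetP sDS i) => //= _ ->.
rewrite /chi_seq eD filter_cat filter_rev; move: (enum S) => s; rewrite -!filter_predI.
by congr (_ ++ rev _); apply: eq_filter => i /=; rewrite andbC.
Qed.

Lemma prec_sub chi S D i j : D \subset S -> i \in D -> j \in D ->
  prec chi D i j = prec chi S i j.
Proof. by move=> sDS iD jD; rewrite /prec (chi_seq_sub _ sDS) index_filter_lt. Qed.

Fact restr_noncrossing chi S D (sDS : D \subset S) (p : setpart S) :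
  noncrossing chi S p -> noncrossing chi D (restr sDS p).
Proof.
move=> /forall_inP nc; apply/forall_inP => _ /restr_block[V pV ->].
apply/forall_inP => _ /restr_block[W pW ->]; apply/implyP => nVW.
have {}nVW : V != W by apply: contraNneq nVW => ->.
have /forall_inP/(_ W pW)/implyP/(_ nVW) := nc V pV.
apply: contraNN => /exists_inP[s1 /setIP[s1V s1D]] /exists_inP[r1 /setIP[r1W r1D]].
move=> /exists_inP[s2 /setIP[s2V s2D]] /exists_inP[r2 /setIP[r2W r2D]].
rewrite !(prec_sub _ sDS) // => H.
apply/exists_inP; exists s1 => //; apply/exists_inP; exists r1 => //.
by apply/exists_inP; exists s2 => //; apply/exists_inP; exists r2.
Qed.

Fact restr_interval chi S D (sDS : D \subset S) (p : setpart S) :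
  chi_interval chi S p -> chi_interval chi D (restr sDS p).
Proof.
move=> /forall_inP iv; apply/forall_inP => _ /restr_block[V pV ->].
apply/forall_inP => i /setIP[iV _]; apply/forall_inP => k /setIP[kV _].
apply/forall_inP => j jD; apply/implyP => H; rewrite inE jD andbT.
have /forall_inP/(_ i iV)/forall_inP/(_ k kV)/forall_inP := iv V pV.
by move=> /(_ j (subsetP sDS j jD))/implyP; apply.
Qed.

Fact restr_NC_subproof chi S D (sDS : D \subset S) (p : IBNC chi S) :
  noncrossing chi D (restr sDS p).
Proof. by apply: restr_noncrossing; case/andP: (IBNC_partP p). Qed.

Definition restr_NC chi S D (sDS : D \subset S) (p : IBNC chi S) : NC chi D :=
  NCPart (restr_NC_subproof sDS p).

Fact restr_IBNC_subproof chi S D (sDS : D \subset S) (p : IBNC chi S) :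
  noncrossing chi D (restr sDS p) && chi_interval chi D (restr sDS p).
Proof.
by case/andP: (IBNC_partP p) => nc iv; rewrite restr_noncrossing ?restr_interval.
Qed.

Definition restr_IBNC chi S D (sDS : D \subset S) (p : IBNC chi S) : IBNC chi D :=
  IBNCPart (restr_IBNC_subproof sDS p).

Definition itv (a b : 'I_n.+1) : {set 'I_n.+1} := [set i : 'I_n.+1 | a <= i <= b].

Definition cuts chi : seq 'I_n.+1 :=
  [seq i : 'I_n.+1 <- enum 'I_n.+1 | (chi i == Center) && (0 < i < n)].

(* cut chi k is l_k for 0 <= k <= m + 1, where m = size (cuts chi). *)
Definition cut chi (k : nat) : 'I_n.+1 := nth ord0 (ord0 :: rcons (cuts chi) ord_max) k.

(* Indices are shifted by one: this is the restriction to [l_i, l_(i+1)] for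
   0 <= i <= m, usually written alpha_(i+1). *)
Definition alpha_comp chi (i : nat) (p : IBNC chi setT) :
    NC chi (itv (cut chi i) (cut chi i.+1)) :=
  restr_NC (subsetT _) p.

Definition alpha' chi (p : IBNC chi setT) : IBNC chi (itv (cut chi 1) ord_max) :=
  restr_IBNC (subsetT _) p.

Definition alpha1' chi (p : IBNC chi setT) :
    NC chi (itv (cut chi 0) (cut chi 1)) *p IBNC chi (itv (cut chi 1) ord_max) :=
  (alpha_comp 0 p, alpha' p).

Definition alpha chi (p : IBNC chi setT) :
    {dffun forall i : 'I_(size (cuts chi)).+1,
       NC chi (itv (cut chi i) (cut chi i.+1))} :=
  [ffun i : 'I_(size (cuts chi)).+1 => alpha_comp i p].

End BiNoncrossing.

(* Main.v *)
Require Import Defs.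
From mathcomp Require Import all_boot all_order.
From mathcomp Require Import zify.

(** A block of an interval-bi-noncrossing partition that meets both sides of an
    interior point [l] with [chi l = Center] must contain [l]; so the partition
    is determined by its restrictions to the two sides of [l], and also the
    refinement order can be tested on the two sides ([ibnc_subrel_glue]).

    Conversely, given such a partition on each side, merge the two blocks
    containing [l].  In terms of the equivalence relations [R1] and [R2], this
    is the intersection of two pullbacks, by the retractions of the whole
    interval onto its lower and upper parts that collapse the other part to
    [l].  For [prec chi], the upper part is a contiguous run starting at [l],
    because [l] itself is on the increasing side.  Hence the first retraction is
    monotone, and the second one is monotone up to a rotation that moves some
    copies of [l] to the end; both pullbacks are noncrossing ([ibnc_clamp_low],
    [ibnc_clamp_high]), and so is their intersection ([ibnc_glue]).

    This says that [alpha1'] is an order embedding and is surjective.  For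
    [alpha], the cuts are treated one after the other, starting from the last
    one ([tail_glue], [tail_subrel]).  On a segment between consecutive cuts
    no interior point is central, so noncrossing partitions of it are
    automatically interval ([NC_cut_rel]).

    Finally, [IBNC] is stable under intersection of equivalence relations and
    contains the one-block partition, so, being finite, it is a lattice
    ([IBNC_lattice]); order isomorphisms carry the lattice structure over to the
    products ([order_isomorphism_lattice]). *)

Set Implicit Arguments.
Unset Strict Implicit.
Unset Printing Implicit Defensive.

Import Order.TTheory.

(** * Finite lattices and order isomorphisms *)

Section Posets.

Variables (d d' : Order.disp_t).

(** The join is a minimal upper bound, which exists by finiteness and thanks to
    [top]: its meet with any other upper bound is again an upper bound, hence
    equal to it by minimality. *)
Lemma finite_meet_top_lattice (T : finPOrderType d) (top : T) :
    (forall x, x <= top)%O ->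
    (forall x y : T, exists z, is_glb x y z) ->
  is_lattice T.
Proof.
move=> le_top meets x y; split; first exact: meets.
pose ub z := ((x <= z) && (y <= z))%O.
have ub_top : ub top by rewrite /ub !le_top.
(* The size of the principal down-set is strictly monotone for the order. *)
case: (@arg_minnP _ top ub (fun z => #|[set t | t <= z]%O|) ub_top).
move=> z /andP[xz yz] zmin; exists z; split=> // t xt yt.
have [w [wz wt glb_w]] := meets z t.
suff <- : w = z by [].
have ub_w : ub w by rewrite /ub !glb_w.
have sub_wz : [set u | (u <= w)%O] \subset [set u | (u <= z)%O].
  by apply/subsetP => u; rewrite !inE => /le_trans; apply.
have /setP/(_ z) : [set u | (u <= w)%O] = [set u | (u <= z)%O].
  by apply/eqP; rewrite eqEcard sub_wz zmin.
by rewrite !inE lexx => zw; apply/le_anti; rewrite wz zw.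
Qed.

Lemma order_isomorphism_lattice (T : finPOrderType d) (T' : porderType d')
    (f : T -> T') :
    is_lattice T -> {mono f : x y / (x <= y)%O} ->
    (forall y, exists x, f x = y) ->
  lattice_isomorphism f.
Proof.
move=> latT f_mono f_surj.
have surjb y : exists x, f x == y by have [x <-] := f_surj y; exists x.
pose g y := xchoose (surjb y).
have gK : cancel g f by move=> y; apply/eqP/(xchooseP (surjb y)).
have f_inj : injective f.
  by move=> x y e; apply/le_anti; rewrite -!f_mono e lexx.
have fK : cancel f g by move=> x; apply: f_inj; rewrite gK.
have f_glb x y z : is_glb x y z -> is_glb (f x) (f y) (f z).
  move=> [zx zy zglb]; split; rewrite ?f_mono // => t.
  by rewrite -(gK t) !f_mono; apply: zglb.
have f_lub x y z : is_lub x y z -> is_lub (f x) (f y) (f z).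
  move=> [zx zy zlub]; split; rewrite ?f_mono // => t.
  by rewrite -(gK t) !f_mono; apply: zlub.
split=> // [x y|]; last by exists g.
have [[z glb_z] [w lub_w]] := latT (g x) (g y).
rewrite -(gK x) -(gK y).
by split; [exists (f z); apply: f_glb | exists (f w); apply: f_lub].
Qed.

End Posets.

(** * Partitions as equivalence relations *)

Lemma equivalence_rel_in (T : Type) (D : {pred T}) (R : rel T) :
    {in D & &, equivalence_rel R} ->
  [/\ {in D, reflexive R}, {in D &, symmetric R} & {in D & &, transitive R}].
Proof.
move=> eqR.
have refl x : x \in D -> R x x by move=> xD; have [] := eqR x x x xD xD xD.
have half x y : x \in D -> y \in D -> R x y -> R y x.
  by move=> xD yD xy; have [_ <-] := eqR x y x xD yD xD; rewrite ?refl.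
split=> // [x y xD yD | y x z yD xD zD xy yz].
  by apply/idP/idP; apply: half.
by have [_ ->] := eqR x y z xD yD zD.
Qed.

Section SameBlock.

Variable T : finType.
Implicit Types S D : {set T}.

Definition same (P : {set {set T}}) (x y : T) : bool := y \in pblock P x.

Lemma sameP S (p : setpart S) x y :
  reflect (exists2 B, B \in blocks p & (x \in B) && (y \in B)) (same p x y).
Proof.
have /and3P[/eqP cv tI _] := setpartP p.
apply: (iffP idP) => [xy | [B pB /andP[xB yB]]]; last first.
  by rewrite /same (def_pblock tI pB xB).
have xS : x \in cover p.
  apply: contraLR xy => xS; rewrite /same /pblock; case: pickP xS => [B|].
    by move=> /andP[pB xB] /bigcupP[]; exists B.
  by rewrite inE.
by exists (pblock p x); rewrite ?pblock_mem // mem_pblock xS.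
Qed.

Lemma same_in S (p : setpart S) x y : same p x y -> (x \in S) && (y \in S).
Proof.
have /and3P[/eqP cv _ _] := setpartP p.
move=> /sameP[B pB /andP[xB yB]]; rewrite -cv.
by apply/andP; split; apply/bigcupP; exists B.
Qed.

Lemma same_equiv S (p : setpart S) : {in S & &, equivalence_rel (same p)}.
Proof. exact: pblock_equivalence (setpartP p). Qed.

Lemma leP_same S (p q : setpart S) :
  reflect (forall x y, same p x y -> same q x y) (p <= q)%O.
Proof.
apply: (iffP (refinesP p q)) => [pq x y /sameP[B pB /andP[xB yB]] | pq B pB].
  have [B' qB' BB'] := pq B pB.
  by apply/sameP; exists B'; rewrite ?(subsetP BB').
have /and3P[/eqP cv _ n0] := setpartP p.
have /set0Pn[x xB] : B != set0 by apply: contraNneq n0 => <-.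
have /sameP[B' qB' /andP[xB' _]] : same q x x.
  by apply: pq; apply/sameP; exists B; rewrite ?xB.
exists B' => //; apply/subsetP => y yB.
have /and3P[_ tI _] := setpartP q.
have : same q x y by apply: pq; apply/sameP; exists B; rewrite ?xB.
by rewrite /same (def_pblock tI qB' xB').
Qed.

Lemma setpart_eq S (p q : setpart S) :
  {in S &, same p =2 same q} -> p = q.
Proof.
move=> pq; apply/le_anti/andP.
by split; apply/leP_same => x y xy; have /andP[xS yS] := same_in xy;
  rewrite (pq, =^~ pq).
Qed.

Lemma same_restr S D (sDS : D \subset S) (p : setpart S) :
  {in D &, same (restr sDS p) =2 same p}.
Proof.
move=> x y xD yD; apply/sameP/sameP => [[_ /restr_block[B pB ->]] | [B pB]].
  by rewrite !inE xD yD !andbT; exists B.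
move=> /andP[xB yB]; exists (B :&: D); last by rewrite !inE xB yB xD yD.
rewrite /= /restr_blocks in_setD1 (imset_f (fun B => B :&: D)) // andbT.
by apply/set0Pn; exists x; rewrite inE xB.
Qed.

Lemma restr_leP S D (sDS : D \subset S) (p q : setpart S) :
  reflect {in D &, subrel (same p) (same q)} (restr sDS p <= restr sDS q)%O.
Proof.
apply: (iffP (leP_same _ _)) => [pq x y xD yD | pq x y rxy].
  by have := pq x y; rewrite !same_restr.
have /andP[xD yD] := same_in rxy.
by move: rxy; rewrite !same_restr //; apply: pq.
Qed.

Lemma setpart_of_rel S (R : rel T) : {in S & &, equivalence_rel R} ->
  exists p : setpart S, {in S &, same p =2 R}.
Proof.
move=> eqR; exists (SetPart (equivalence_partitionP eqR)) => x y.
exact: pblock_equivalence_partition.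
Qed.

End SameBlock.

(** * Interval-bi-noncrossing equivalence relations *)

Section Rank.

Variables (n : nat) (chi : 'I_n.+1 -> color).
Implicit Types (S D : {set 'I_n.+1}) (i j x y : 'I_n.+1) (R : rel 'I_n.+1).

(** An integer height inducing [prec chi] on every subset at once: [i] keeps its
    value on the increasing side, while the right-coloured points come after,
    in reverse order; the offset [2 * (n + 1)] keeps their heights above [n]. *)
Definition chi_rank i : nat := if chi i is Right then n.+1.*2 - i else i.

Lemma chi_rank_inj : injective chi_rank.
Proof.
move=> i j; rewrite /chi_rank => e; apply: val_inj => /=.
have := ltn_ord i; have := ltn_ord j.
by case: (chi i) e; case: (chi j); lia.
Qed.

Lemma chi_seq_sorted S : sorted (relpre chi_rank ltn) (chi_seq chi S).
Proof.
have tr : transitive (relpre chi_rank ltn) by move=> y x z /=; apply: ltn_trans.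
have enum_sorted a : sorted (relpre val ltn) [seq i <- enum S | a i].
  have tv : transitive (relpre (val : 'I_n.+1 -> nat) ltn).
    by move=> y x z /=; apply: ltn_trans.
  rewrite (sorted_filter tv) // (sorted_filter tv) //.
  by rewrite -sorted_map -enumT val_enum_ord iota_ltn_sorted.
rewrite (sorted_pairwise tr) pairwise_cat -!(sorted_pairwise tr) rev_sorted.
apply/and3P; split.
- apply/allrelP => x y; rewrite mem_rev !mem_filter /chi_rank /=.
  by have := ltn_ord x; have := ltn_ord y; case: (chi x); case: (chi y) => //=; lia.
- apply: sub_in_sorted (filter_all _ _) (enum_sorted _) => x y.
  by rewrite !unfold_in /chi_rank /=; case: (chi x); case: (chi y).
- apply: (@sub_in_sorted _ _ (relpre val ltn)) (filter_all _ _) (enum_sorted _) => x y.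
  rewrite !unfold_in /chi_rank /=; have := ltn_ord x; have := ltn_ord y.
  by case: (chi x); case: (chi y) => //=; lia.
Qed.

Lemma prec_rank S : {in S &, forall i j, prec chi S i j = (chi_rank i < chi_rank j)}.
Proof.
move=> i j iS jS; rewrite /prec.
have mem k : k \in S -> k \in chi_seq chi S.
  rewrite -mem_enum /chi_seq; move: (enum S) => s ks.
  by rewrite mem_cat mem_rev !mem_filter ks !andbT orNb.
have tr : transitive (relpre chi_rank ltn) by move=> y x z /=; apply: ltn_trans.
have lt := sorted_ltn_index tr (chi_seq_sorted S).
apply/idP/idP => [|ij]; first by apply: lt; apply: mem.
case: ltngtP => // [/(lt _ _ (mem _ jS) (mem _ iS)) /= ji | e].
  by rewrite ltnNge ltnW in ij.
by rewrite -(nth_index ord0 (mem _ iS)) e nth_index ?mem // ltnn in ij.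
Qed.

(** All inequalities are weak, contrary to the strict ones defining [noncrossing]
    and [chi_interval].  When two of the points coincide the conclusion follows
    from the equivalence axioms, so the conditions are the same; in this form
    they pull back along weakly monotone maps. *)
Record ibnc_rel S R : Prop := IbncRel {
  ibnc_equiv : {in S & &, equivalence_rel R};
  ibnc_noncrossing : forall a b c d, [/\ a \in S, b \in S, c \in S & d \in S] ->
    chi_rank a <= chi_rank b <= chi_rank c -> chi_rank c <= chi_rank d ->
    R a c -> R b d -> R a b;
  ibnc_interval : forall i j k, [/\ i \in S, j \in S & k \in S] -> i <= j <= k ->
    chi j = Center -> R i k -> R i j }.

Lemma ibnc_refl S R : ibnc_rel S R -> {in S, reflexive R}.
Proof. by case=> /equivalence_rel_in[]. Qed.

Lemma ibnc_sym S R : ibnc_rel S R -> {in S &, symmetric R}.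
Proof. by case=> /equivalence_rel_in[]. Qed.

Lemma ibnc_trans S R : ibnc_rel S R -> {in S & &, transitive R}.
Proof. by case=> /equivalence_rel_in[]. Qed.

Lemma ibnc_same S (p : setpart S) :
  reflect (ibnc_rel S (same p)) (noncrossing chi S p && chi_interval chi S p).
Proof.
have /and3P[/eqP cv tI _] := setpartP p.
have blockS V x : V \in blocks p -> x \in V -> x \in S.
  by move=> pV xV; rewrite -cv; apply/bigcupP; exists V.
have same_block V x y : V \in blocks p -> x \in V -> y \in V -> same p x y.
  by move=> pV xV yV; apply/sameP; exists V; rewrite ?xV.
have block_eq V W x y : V \in blocks p -> W \in blocks p -> x \in V -> y \in W ->
    same p x y -> V = W.
  by move=> pV pW xV yW; rewrite /same (def_pblock tI pV xV) => yV;
    rewrite -(def_pblock tI pV yV) (def_pblock tI pW yW).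
apply: (iffP andP) => [[nc itvl] | ib]; split.
- exact: same_equiv.
- have [refl sym trans] := equivalence_rel_in (same_equiv p).
  move=> a b c d [aS bS cS dS] /andP[ab bc] cd ac bd.
  case: (ltngtP (chi_rank a) (chi_rank b)) ab => // [ab _|/chi_rank_inj-> _];
    last exact: refl.
  case: (ltngtP (chi_rank b) (chi_rank c)) bc => // [bc _|/chi_rank_inj-> _];
    last by [].
  case: (ltngtP (chi_rank c) (chi_rank d)) cd => // [cd _|/chi_rank_inj cd _];
    last by apply: trans ac _; rewrite // cd sym.
  have /sameP[V pV /andP[aV cV]] := ac; have /sameP[W pW /andP[bW dW]] := bd.
  have [eVW | nVW] := eqVneq V W; first by apply: same_block aV _; rewrite ?eVW.
  have /forall_inP/(_ V pV)/forall_inP/(_ W pW)/implyP/(_ nVW)/negP[] := nc.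
  apply/exists_inP; exists a => //; apply/exists_inP; exists b => //.
  apply/exists_inP; exists c => //; apply/exists_inP; exists d => //.
  by rewrite !prec_rank // ab bc.
- move=> i j k [iS jS kS] /andP[ij jk] cj ik.
  have [refl _ _] := equivalence_rel_in (same_equiv p).
  case: (ltngtP i j) ij => // [ij _|/val_inj-> _]; last exact: refl.
  case: (ltngtP j k) jk => // [jk _|/val_inj-> _]; last by [].
  have /sameP[V pV /andP[iV kV]] := ik.
  have /forall_inP/(_ V pV)/forall_inP/(_ i iV)/forall_inP/(_ k kV) := itvl.
  move=> /forall_inP/(_ j jS); rewrite ij jk cj /=.
  exact: same_block pV iV.
- apply/forall_inP => V pV; apply/forall_inP => W pW; apply/implyP.
  apply: contraNN => /exists_inP[a aV] /exists_inP[b bW] /exists_inP[c cV].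
  move=> /exists_inP[d dW].
  have [aS cS] := (blockS _ _ pV aV, blockS _ _ pV cV).
  have [bS dS] := (blockS _ _ pW bW, blockS _ _ pW dW).
  rewrite !prec_rank // => /and3P[ab bc cd].
  apply/eqP; apply: (block_eq V W a b) => //.
  apply: (ibnc_noncrossing ib (c := c) (d := d)) => //;
    rewrite ?(ltnW ab, ltnW bc, ltnW cd) //.
    exact: same_block cV.
  exact: same_block dW.
- apply/forall_inP => V pV; apply/forall_inP => i iV; apply/forall_inP => k kV.
  apply/forall_inP => j jS; apply/implyP => /andP[/andP[ij jk] /eqP cj].
  have [iS kS] := (blockS _ _ pV iV, blockS _ _ pV kV).
  have : same p i j.
    apply: (ibnc_interval ib (k := k)) cj _ => //.
      by rewrite (ltnW ij) (ltnW jk).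
    exact: same_block kV.
  by rewrite /same (def_pblock tI pV iV).
Qed.

Lemma ibnc_true S : ibnc_rel S (fun _ _ => true).
Proof. by []. Qed.

Lemma ibnc_rel_and S R1 R2 : ibnc_rel S R1 -> ibnc_rel S R2 ->
  ibnc_rel S (fun x y => R1 x y && R2 x y).
Proof.
move=> ib1 ib2; split.
- move=> x y z xS yS zS; have [r1 t1] := ibnc_equiv ib1 xS yS zS.
  have [r2 t2] := ibnc_equiv ib2 xS yS zS; rewrite r1 r2.
  by split=> // /andP[/t1-> /t2->].
- move=> a b c d inS abc cd /andP[ac1 ac2] /andP[bd1 bd2].
  by rewrite (ibnc_noncrossing ib1 inS abc cd) ?(ibnc_noncrossing ib2 inS abc cd).
- move=> i j k inS ijk cj /andP[ik1 ik2].
  by rewrite (ibnc_interval ib1 inS ijk) // (ibnc_interval ib2 inS ijk).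
Qed.

(** * Gluing at a central point *)

Section Clamp.

(* The second alternative covers the last cut, the endpoint of the whole
   interval, whose colour is arbitrary. *)
Variables (l : 'I_n.+1) (S : {set 'I_n.+1}).
Hypothesis l_cut : chi l = Center \/ {in S, forall x, x <= l}.

Definition clamp_low x : 'I_n.+1 := if x <= l then x else l.
Definition clamp_high x : 'I_n.+1 := if l <= x then x else l.

(** Collapsing to [l] the points above it is weakly monotone for [chi_rank],
    since these form a contiguous run that follows [l]. *)
Lemma ibnc_clamp_low R : l \in S ->
  ibnc_rel [set x in S | x <= l] R ->
  ibnc_rel S (fun x y => R (clamp_low x) (clamp_low y)).
Proof.
set D := [set x in S | _] => lS ib.
have clampD x : x \in S -> clamp_low x \in D.
  by rewrite /clamp_low; case: ifP => xl xS; rewrite inE ?xS ?xl ?lS ?leqnn.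
have mono x y : x \in S -> y \in S -> chi_rank x <= chi_rank y ->
    chi_rank (clamp_low x) <= chi_rank (clamp_low y).
  move=> xS yS; case: l_cut => [cl|lmax]; last by rewrite /clamp_low !lmax.
  have := ltn_ord x; have := ltn_ord y; have := ltn_ord l.
  rewrite /clamp_low; do 2?case: ifP; rewrite /chi_rank ?cl;
    case: (chi x); case: (chi y); lia.
split.
- by move=> x y z xS yS zS; apply: (ibnc_equiv ib); apply: clampD.
- move=> a b c d [aS bS cS dS] /andP[ab bc] cd.
  by apply: (ibnc_noncrossing ib); rewrite ?mono //; split; apply: clampD.
- move=> i j k [iS jS kS] /andP[ij jk] cj; rewrite [clamp_low j]/clamp_low.
  case: ifP => jl; last by rewrite {2}/clamp_low ifN //; lia.
  apply: (ibnc_interval ib _ _ cj).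
    by split; rewrite ?clampD // inE jS jl.
  by rewrite /clamp_low; do 2?case: ifP; lia.
Qed.

(** Collapsing to [l] the points below it is weakly monotone on those that do not
    come after the run of upper points.  The others are the right-coloured points
    below [l]: they are sent from the end back to [l], the least upper point.  So
    four points in order are sent to four points in order up to a rotation, and
    noncrossing conditions are invariant under rotation. *)
Lemma ibnc_clamp_high R : l \in S ->
  ibnc_rel [set x in S | l <= x] R ->
  ibnc_rel S (fun x y => R (clamp_high x) (clamp_high y)).
Proof.
set D := [set x in S | _] => lS ib.
have clampD x : x \in S -> clamp_high x \in D.
  by rewrite /clamp_high; case: ifP => xl xS; rewrite inE ?xS ?xl ?lS ?leqnn.
have lD : l \in D by rewrite inE lS leqnn.
split.
- by move=> x y z xS yS zS; apply: (ibnc_equiv ib); apply: clampD.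
- case: l_cut => [cl | lmax]; last first.
    have cst x : x \in S -> clamp_high x = l.
      rewrite /clamp_high => /lmax xl; case: ifP => // lx.
      by apply: val_inj => /=; lia.
    by move=> a b c d [aS bS cS dS] _ _ _ _; rewrite !cst // (ibnc_refl ib).
  pose before x := (l <= x) || (chi x != Right).
  have after x : ~~ before x -> clamp_high x = l.
    by rewrite /before /clamp_high; case: ifP.
  have l_le x : x \in S -> chi_rank l <= chi_rank (clamp_high x).
    move=> xS; have := ltn_ord x; rewrite /clamp_high.
    by case: ifP; rewrite /chi_rank cl; case: (chi x); lia.
  have mono x y : before y -> chi_rank x <= chi_rank y ->
      chi_rank (clamp_high x) <= chi_rank (clamp_high y).
    rewrite /before; have := ltn_ord x; have := ltn_ord y; have := ltn_ord l.
    rewrite /clamp_high; do 2?case: ifP; rewrite /chi_rank ?cl;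
      case: (chi x); case: (chi y) => //=; lia.
  have down x y : before y -> chi_rank x <= chi_rank y -> before x.
    rewrite /before; have := ltn_ord x; have := ltn_ord y; have := ltn_ord l.
    by rewrite /chi_rank; case: (chi x); case: (chi y) => //=; lia.
  move=> a b c d [aS bS cS dS] /andP[ab bc] cd ac bd.
  have [bd_ | /after ed] := boolP (before d).
    have bc_ := down _ _ bd_ cd; have bb_ := down _ _ bc_ bc.
    by apply: (ibnc_noncrossing ib) ac bd; rewrite ?mono //; split; apply: clampD.
  (* Now [d] is sent to [l]; it is moved to the front, as [l, a, b, c]. *)
  rewrite {}ed (ibnc_sym ib) ?clampD // in bd.
  have la : R l (clamp_high a).
    have [bc_ | /after ec] := boolP (before c); last first.
      by rewrite ec in ac; rewrite (ibnc_sym ib) ?clampD.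
    have bb_ := down _ _ bc_ bc.
    apply: (ibnc_noncrossing ib) bd ac; rewrite ?l_le ?mono //.
    by split; rewrite ?clampD.
  rewrite (ibnc_sym ib) ?clampD // in la.
  by apply: (ibnc_trans ib) la bd; rewrite ?clampD.
- move=> i j k [iS jS kS] /andP[ij jk] cj.
  have [lj | jl] := boolP (l <= j); last first.
    by move=> _; rewrite /clamp_high !ifN ?(ibnc_refl ib) //; lia.
  rewrite [clamp_high j]/clamp_high lj.
  apply: (ibnc_interval ib _ _ cj).
    by split; rewrite ?clampD // inE jS lj.
  by rewrite /clamp_high; do 2?case: ifP; lia.
Qed.

(** The witness relates a lower [x] to an upper [y] when [R1 x l] and [R2 l y]:
    the classes of [l] for [R1] and [R2] are merged. *)
Lemma ibnc_glue R1 R2 : l \in S ->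
    ibnc_rel [set x in S | x <= l] R1 -> ibnc_rel [set x in S | l <= x] R2 ->
  exists R, [/\ ibnc_rel S R, {in [set x in S | x <= l] &, R =2 R1}
               & {in [set x in S | l <= x] &, R =2 R2}].
Proof.
move=> lS ib1 ib2.
exists (fun x y =>
  R1 (clamp_low x) (clamp_low y) && R2 (clamp_high x) (clamp_high y)).
have low_high x : l <= x -> clamp_low x = l.
  by rewrite /clamp_low; case: ifP => // xl lx; apply: val_inj => /=; lia.
have high_low x : x <= l -> clamp_high x = l.
  by rewrite /clamp_high; case: ifP => // lx xl; apply: val_inj => /=; lia.
split.
- exact: ibnc_rel_and (ibnc_clamp_low lS ib1) (ibnc_clamp_high lS ib2).
- move=> x y; rewrite !inE => /andP[_ xl] /andP[_ yl].
  by rewrite !high_low // /clamp_low xl yl (ibnc_refl ib2) ?andbT // inE lS leqnn.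
- move=> x y; rewrite !inE => /andP[_ xl] /andP[_ yl].
  by rewrite !low_high // /clamp_high xl yl (ibnc_refl ib1) // inE lS leqnn.
Qed.

(** If [x < l < y] are related, the interval condition puts [l] between them in
    their class, and inclusion is then tested on each side. *)
Lemma ibnc_subrel_glue R1 R2 : l \in S -> ibnc_rel S R1 -> ibnc_rel S R2 ->
    {in [set x in S | x <= l] &, subrel R1 R2} ->
    {in [set x in S | l <= x] &, subrel R1 R2} ->
  {in S &, subrel R1 R2}.
Proof.
move=> lS ib1 ib2 low high x y.
wlog xy : x y / x <= y => [wl|] xS yS.
  have [xy|/ltnW yx] := leqP x y; first exact: wl.
  by rewrite (ibnc_sym ib1) // (ibnc_sym ib2) //; apply: wl.
have [yl|ly] := leqP y l.
  by apply: low; rewrite inE ?xS ?yS // (leq_trans xy).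
have [lx|xl] := leqP l x.
  by apply: high; rewrite inE ?xS ?yS // (leq_trans lx).
case: l_cut => [cl R1xy|/(_ y yS)]; last by rewrite leqNgt ly.
have R1xl : R1 x l.
  by apply: (ibnc_interval ib1 _ _ cl) R1xy => //; rewrite (ltnW xl) (ltnW ly).
have R1ly : R1 l y.
  by apply: (ibnc_trans ib1) R1xy => //; rewrite (ibnc_sym ib1).
apply: (ibnc_trans ib2 lS) => //.
  by apply: low R1xl; rewrite inE ?xS ?lS ?leqnn // ltnW.
by apply: high R1ly; rewrite inE ?yS ?lS ?leqnn // ltnW.
Qed.

End Clamp.

(** * The lattice of interval-bi-noncrossing partitions *)

Lemma ibnc_sub S D R : D \subset S -> ibnc_rel S R -> ibnc_rel D R.
Proof.
move=> /subsetP DS ib; split.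
- by move=> x y z /DS xS /DS yS /DS zS; apply: (ibnc_equiv ib).
- by move=> a b c d [/DS aS /DS bS /DS cS /DS dS]; apply: (ibnc_noncrossing ib).
- by move=> i j k [/DS iS /DS jS /DS kS]; apply: (ibnc_interval ib).
Qed.

Lemma eq_ibnc S R R' : {in S &, R =2 R'} -> ibnc_rel S R' -> ibnc_rel S R.
Proof.
move=> eR ib; split.
- by move=> x y z xS yS zS; rewrite !eR //; apply: (ibnc_equiv ib).
- move=> a b c d inS; have [aS bS cS dS] := inS; rewrite !eR //.
  exact: (ibnc_noncrossing ib).
- move=> i j k inS; have [iS jS kS] := inS; rewrite !eR //.
  exact: (ibnc_interval ib).
Qed.

Lemma IBNC_rel S (p : IBNC chi S) : ibnc_rel S (same p).
Proof. exact/ibnc_same/IBNC_partP. Qed.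

Lemma IBNC_of_rel S R : ibnc_rel S R ->
  exists p : IBNC chi S, {in S &, same p =2 R}.
Proof.
move=> ib; have [p pR] := setpart_of_rel (ibnc_equiv ib).
by have /ibnc_same ibp := eq_ibnc pR ib; exists (IBNCPart ibp).
Qed.

Lemma IBNC_leP S (p q : IBNC chi S) :
  reflect (forall x y, same p x y -> same q x y) (p <= q)%O.
Proof. exact: leP_same. Qed.

Lemma IBNC_lattice S : is_lattice (IBNC chi S).
Proof.
have [top topE] := IBNC_of_rel (ibnc_true S).
apply: (finite_meet_top_lattice (top := top)) => [p | p q].
  by apply/IBNC_leP => x y /same_in/andP[xS yS]; rewrite topE.
have [r rE] := IBNC_of_rel (ibnc_rel_and (IBNC_rel p) (IBNC_rel q)).
have r_pq x y : same r x y -> same p x y && same q x y.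
  by move=> rxy; have /andP[xS yS] := same_in rxy; rewrite -rE.
exists r; split.
- by apply/IBNC_leP => x y /r_pq/andP[].
- by apply/IBNC_leP => x y /r_pq/andP[].
- move=> t /IBNC_leP tp /IBNC_leP tq; apply/IBNC_leP => x y txy.
  by have /andP[xS yS] := same_in txy; rewrite rE // tp ?tq.
Qed.

(** * The cuts *)

Local Notation m := (size (cuts chi)).
Local Notation cut := (cut chi).

Lemma cut_leq (i j : nat) : i <= j <= m.+1 -> cut i <= cut j.
Proof.
move=> /andP[ij jm].
have tr : transitive (relpre (val : 'I_n.+1 -> nat) leq).
  by move=> y x z /=; apply: leq_trans.
have refl : reflexive (relpre (val : 'I_n.+1 -> nat) leq) by move=> x /=.
apply: (sorted_leq_nth tr refl ord0) => //; rewrite ?inE /= ?size_rcons ?ltnS //;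
  last exact: leq_trans jm.
rewrite (path_sortedE tr); apply/andP; split; first by apply/allP.
rewrite (sorted_pairwise tr) pairwise_rcons -(sorted_pairwise tr).
apply/andP; split; first by apply/allP => x _ /=; rewrite leq_ord.
rewrite /cuts (sorted_filter tr) //.
by rewrite -sorted_map val_enum_ord iota_sorted.
Qed.

Lemma cut_last : cut m.+1 = ord_max.
Proof. by rewrite /Defs.cut /= nth_rcons ltnn eqxx. Qed.

Lemma cut_center k : k < m -> chi (cut k.+1) = Center.
Proof.
move=> km; rewrite /Defs.cut /= nth_rcons km.
by have := mem_nth ord0 km; rewrite mem_filter => /andP[/andP[/eqP]].
Qed.

Lemma cut_center_or_max k : k <= m ->
  chi (cut k.+1) = Center \/ forall x, x <= cut k.+1.
Proof.
rewrite leq_eqVlt => /predU1P[-> | /cut_center]; last by left.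
by right=> x; rewrite cut_last leq_ord.
Qed.

Lemma center_cut j : chi j = Center -> 0 < j < n ->
  exists2 k, k < m & j = cut k.+1.
Proof.
move=> cj jn; have jc : j \in cuts chi by rewrite mem_filter cj eqxx jn mem_enum.
exists (index j (cuts chi)); first by rewrite index_mem.
by rewrite /Defs.cut /= nth_rcons index_mem jc nth_index.
Qed.

Lemma no_center_between_cuts k j : k <= m -> cut k < j < cut k.+1 ->
  chi j != Center.
Proof.
move=> km /andP[kj jk]; apply/eqP => cj.
have jn : 0 < j < n by have := leq_ord (cut k.+1); lia.
have [i im ej] := center_cut cj jn; subst j.
have [ik|ki] := leqP i.+1 k.
  by have := @cut_leq i.+1 k; rewrite ik leqW //= => /(_ isT); lia.
by have := @cut_leq k.+1 i.+1; rewrite ki /= ltnS (ltnW im) => /(_ isT); lia.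
Qed.

(** The interval condition only concerns central points strictly inside the
    segment, and there are none. *)
Lemma NC_cut_rel k (q : NC chi (itv (cut k) (cut k.+1))) : k <= m ->
  ibnc_rel (itv (cut k) (cut k.+1)) (same q).
Proof.
move=> km; apply/ibnc_same; rewrite NC_partP /=.
have /and3P[/eqP cv _ _] := setpartP q.
have blockS V x : V \in blocks q -> x \in V -> cut k <= x <= cut k.+1.
  move=> qV xV; have : x \in cover q by apply/bigcupP; exists V.
  by rewrite cv inE.
apply/forall_inP => V qV; apply/forall_inP => i iV; apply/forall_inP => l lV.
apply/forall_inP => j _; apply/implyP => /andP[ijl /eqP cj].
have /andP[ki _] := blockS _ _ qV iV; have /andP[_ lk] := blockS _ _ qV lV.
by have := @no_center_between_cuts k j km; rewrite cj eqxx => /(_ _)/idP; lia.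
Qed.

Lemma itv_low (a l b : 'I_n.+1) : l <= b -> [set x in itv a b | x <= l] = itv a l.
Proof. by move=> lb; apply/setP => x; rewrite !inE; lia. Qed.

Lemma itv_high (a l b : 'I_n.+1) : a <= l -> [set x in itv a b | l <= x] = itv l b.
Proof. by move=> lb; apply/setP => x; rewrite !inE; lia. Qed.

Lemma itv_full : itv ord0 ord_max = [set: 'I_n.+1].
Proof. by apply/setP => x; rewrite !inE leq_ord. Qed.

Local Notation tail k := (itv (cut k) ord_max).
Local Notation segment k := (itv (cut k) (cut k.+1)).

Lemma tail_glue k R1 R2 : k <= m ->
    ibnc_rel (segment k) R1 -> ibnc_rel (tail k.+1) R2 ->
  exists R, [/\ ibnc_rel (tail k) R, {in segment k &, R =2 R1}
               & {in tail k.+1 &, R =2 R2}].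
Proof.
move=> km ib1 ib2.
have kk : cut k <= cut k.+1 by apply: cut_leq; rewrite leqnSn.
have kM : cut k.+1 <= (ord_max : 'I_n.+1) by rewrite leq_ord.
rewrite -(itv_low _ kM) -(itv_high _ kk) in ib1 ib2 *.
apply: ibnc_glue => //; last by rewrite inE kk.
by case: (cut_center_or_max km) => [|lmax]; [left | right=> x _].
Qed.

Lemma tail_subrel k R1 R2 : k <= m -> ibnc_rel (tail k) R1 -> ibnc_rel (tail k) R2 ->
    {in segment k &, subrel R1 R2} -> {in tail k.+1 &, subrel R1 R2} ->
  {in tail k &, subrel R1 R2}.
Proof.
move=> km ib1 ib2.
have kk : cut k <= cut k.+1 by apply: cut_leq; rewrite leqnSn.
have kM : cut k.+1 <= (ord_max : 'I_n.+1) by rewrite leq_ord.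
rewrite -(itv_low _ kM) -(itv_high _ kk).
apply: ibnc_subrel_glue => //; last by rewrite inE kk.
by case: (cut_center_or_max km) => [|lmax]; [left | right=> x _].
Qed.

(** * The restriction maps *)

Lemma tails_ind (P : nat -> Prop) :
  P m.+1 -> (forall k, k <= m -> P k.+1 -> P k) -> P 0.
Proof.
move=> Pm PS; suff H (j : nat) : j <= m.+1 -> P (m.+1 - j).
  by have := H _ (leqnn m.+1); rewrite subnn.
elim: j => [|j IH] jm; first by rewrite subn0.
by apply: PS; [lia | rewrite -subSn // subSS; apply: IH; apply: ltnW].
Qed.

Lemma alpha1'_mono : {mono @alpha1' n chi : p q / (p <= q)%O}.
Proof.
move=> p q; rewrite Order.ProdOrder.leEprod /=.
apply/andP/IBNC_leP => [[/restr_leP low /restr_leP high] x y| pq]; last first.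
  by split; apply/restr_leP => x y _ _; apply: pq.
suff H : {in tail 0 &, subrel (same p) (same q)}.
  by apply: H; rewrite itv_full inE.
by apply: tail_subrel low high => //; apply: ibnc_sub (subsetT _) (IBNC_rel _).
Qed.

Lemma alpha1'_surj q : exists p, @alpha1' n chi p = q.
Proof.
case: q => q1 q2.
have [R [ibR Rq1 Rq2]] :=
  tail_glue (leq0n m) (NC_cut_rel q1 (leq0n m)) (IBNC_rel q2).
rewrite itv_full in ibR; have [p pR] := IBNC_of_rel ibR.
exists p; congr (_, _); apply/val_inj/setpart_eq => x y xD yD /=;
  by rewrite same_restr // pR ?inE //; first [exact: Rq1 | exact: Rq2].
Qed.

Lemma alpha_mono : {mono @alpha n chi : p q / (p <= q)%O}.
Proof.
move=> p q; apply/forallP/IBNC_leP => [pq | pq i]; last first.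
  by rewrite !ffunE; apply/restr_leP => x y _ _; apply: pq.
suff H : {in tail 0 &, subrel (same p) (same q)}.
  by move=> x y; apply: H; rewrite itv_full inE.
pose P k := {in tail k &, subrel (same p) (same q)}.
apply: (tails_ind (P := P)) => [|k km]; rewrite /P.
  rewrite cut_last => x y; rewrite !inE => xM yM _.
  have -> : x = y.
    apply: val_inj; move: xM yM => /=.
    by have := leq_ord x; have := leq_ord y; lia.
  by apply: (ibnc_refl (IBNC_rel q)); rewrite inE.
apply: tail_subrel => //; try exact: ibnc_sub (subsetT _) (IBNC_rel _).
have := pq (Ordinal (km : k < m.+1)); rewrite !ffunE => /restr_leP.
exact.
Qed.

Lemma alpha_surj f : exists p, @alpha n chi p = f.
Proof.
pose P k := exists R, ibnc_rel (tail k) R /\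
  forall i : 'I_m.+1, k <= i -> {in segment i &, R =2 same (f i)}.
have [R [ibR Rf]] : P 0.
  apply: (tails_ind (P := P)) => [|k km [R2 [ib2 R2f]]].
    exists (fun _ _ => true); split=> [|i]; first exact: ibnc_true.
    by rewrite leqNgt ltn_ord.
  have [R [ibR Rfk RR2]] :=
    tail_glue km (NC_cut_rel (f (Ordinal (km : k < m.+1))) km) ib2.
  exists R; split=> // i; rewrite leq_eqVlt => /predU1P[ki | ki x y xi yi].
    have -> : i = Ordinal (km : k < m.+1) by apply: val_inj.
    exact: Rfk.
  have seg_tail z : z \in segment i -> z \in tail k.+1.
    rewrite !inE => /andP[iz _]; rewrite leq_ord andbT; apply: leq_trans iz.
    by apply: cut_leq; rewrite ki ltnW.
  by rewrite RR2 ?seg_tail //; apply: R2f.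
rewrite itv_full in ibR; have [p pR] := IBNC_of_rel ibR.
exists p; apply/ffunP => i; rewrite ffunE; apply/val_inj/setpart_eq => x y xD yD /=.
by rewrite same_restr // pR ?inE //; apply: Rf.
Qed.

End Rank.

Theorem proposition3p10 (n : nat) (chi : 'I_n.+1 -> color) :
  [/\ lattice_isomorphism (@alpha1' n chi),
      lattice_isomorphism (@alpha n chi)
    & is_lattice (IBNC chi setT)].
Proof.
have lat := @IBNC_lattice n chi setT.
split=> //.
- exact: order_isomorphism_lattice lat (@alpha1'_mono n chi) (@alpha1'_surj n chi).
- exact: order_isomorphism_lattice lat (@alpha_mono n chi) (@alpha_surj n chi).
Qed.
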